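(* Let $n \ge 2$ be an integer, $a \in \mathbb{Z}$, and suppose $f(x) = (x^2+1)^n - a x^n$ is irreducible over $\mathbb{Q}$. Let $\theta$ be a root of $f$, $K = \mathbb{Q}(\theta)$, and $\mathbb{Z}_K$ the ring of integers of $K$. Let $p$ be a prime dividing $\Delta(f)$. Then $p$ does not divide $[\mathbb{Z}_K : \mathbb{Z}[\theta]]$ if and only if the following condition (the one among (i)–(iv) applicable to $p$) holds: (i) if $p \mid a$: $p^2 \nmid a$; (ii) if $p \nmid a$ and $p \mid n$: $p^2 \nmid (a^{p^j} - a)$, where $p^j$ is the highest power of $p$ dividing $n$; (iii) if $p \nmid an$ and $n$ is odd: $p^2 \nmid \Delta(f)$; (iv) if $p \nmid an$ and $n$ is even: $p^2 \nmid (2^n - a)$.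
   Context: $\Delta(f)$ is the discriminant of $f$; it equals $(-1)^{\binom{2n}{2}} n^{2n} a^{2n-2}(2^n-a)(2^n-(-1)^n a)$. $[\mathbb{Z}_K:\mathbb{Z}[\theta]]$ is the (finite) index of the subring $\mathbb{Z}[\theta]$ in $\mathbb{Z}_K$, called the index of $f$. *)

(* Defs.v *)
From HB Require Import structures.
From mathcomp Require Import all_boot all_order all_algebra all_field.
Set Implicit Arguments. Unset Strict Implicit. Unset Printing Implicit Defensive.
Import Order.TTheory GRing.Theory Num.Theory.
Local Open Scope ring_scope.

Definition fpoly (n : nat) (a : int) : {poly int} :=
  ('X ^+ 2 + 1) ^+ n - a%:P * 'X ^+ n.

(* discriminant of a polynomial p (leading coefficient lead_coef p), via the
   resultant of p and its derivative:
   disc p = (-1)^(d(d-1)/2) * Res(p, p') / lc(p), d = deg p.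
   For the monic f here, the division by lc(f)=1 is exact; we use the integer
   quotient. *)
Definition disc (p : {poly int}) : int :=
  let d := (size p).-1 in
  ((-1) ^+ 'C(d, 2) * resultant p p^`() %/ lead_coef p)%Z.

Definition inK (theta : algC) (x : algC) : Prop :=
  exists q : {poly rat}, x = (map_poly ratr q).[theta].

Definition inZK (theta : algC) (x : algC) : Prop :=
  inK theta x /\ x \in Aint.

Definition inZtheta (theta : algC) (x : algC) : Prop :=
  exists q : {poly int}, x = (map_poly intr q).[theta].

(* N is the index [Z_K : Z[theta]]: there are exactly N cosets of Z[theta]
   in Z_K, given by a complete irredundant system of representatives. *)
Definition is_index (theta : algC) (N : nat) : Prop :=
  exists r : 'I_N -> algC,
    [/\ forall i, inZK theta (r i),
        forall x, inZK theta x -> exists i, inZtheta theta (x - r i)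
      & forall i j, inZtheta theta (r i - r j) -> i = j].

(* Main.v *)
Require Import Defs.
From HB Require Import structures.
From mathcomp Require Import all_boot all_order all_algebra all_field.
From mathcomp Require Import all_fingroup all_solvable ring.
Import Order.TTheory GRing.Theory Num.Theory.
Local Open Scope ring_scope.
Set Implicit Arguments.
Unset Strict Implicit.
Unset Printing Implicit Defensive.

(** The prime p divides the index of f iff f lies in the square of some maximal
    ideal (p, q) of Z[X].  If p divides a or n, then modulo every such square
    with q dividing f mod p, f is congruent to c X^n with c = - a, resp.
    c = a ^ (p ^ j) - a, and X is invertible mod q; so the condition is that
    p ^ 2 divides c.  Otherwise the identity
      (X^2 + 1) f' = n a X^(n-1) (X^2 - 1) + 2 n X f
    shows that the only possible q are X - 1 and X + 1, and the condition is that
    p ^ 2 divides f(1) or f(-1).  For n odd these two values are not both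
    divisible by p, and they are the part of the discriminant prime to n a. *)

(** * Primes dividing the number of cosets *)

Section Cosets.

Variables (V : zmodType) (A B : V -> Prop) (N : nat) (r : 'I_N -> V).
Hypothesis A0 : A 0.
Hypothesis AD : forall x y, A x -> A y -> A (x + y).
Hypothesis B0 : B 0.
Hypothesis BB : forall x y, B x -> B y -> B (x - y).
Hypothesis rA : forall i, A (r i).
Hypothesis rcover : forall x, A x -> exists i, B (x - r i).
Hypothesis rinj : forall i j, B (r i - r j) -> i = j.

Let E x y := B (x - y).

Let Exx x : E x x.
Proof. by rewrite /E subrr. Qed.

Let Esym x y : E x y -> E y x.
Proof. by move=> Exy; have := BB B0 Exy; rewrite sub0r opprB. Qed.

Let Etrans y x z : E x y -> E y z -> E x z.
Proof. by move=> Exy /Esym Ezy; have := BB Exy Ezy; rewrite /E opprB addrA subrK. Qed.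

Let ED x x' y y' : E x x' -> E y y' -> E (x + y) (x' + y').
Proof.
move=> Ex /Esym Ey; have := BB Ex Ey.
by rewrite /E opprB addrACA -opprD.
Qed.

(* The translations by the representatives form a permutation group of order N
   on the cosets. *)
Lemma prime_dvd_index_cosets (p : nat) : prime p ->
  (p %| N)%N <-> exists x, [/\ A x, ~ B x & B (x *+ p)].
Proof.
move=> p_pr.
have Er0 x : E x 0 <-> B x by rewrite /E subr0.
(* Choosing a representative of each sum of representatives turns addition of cosets into an
   operation [add] on indices. *)
have ex_add (i : 'I_N) : exists f : 'I_N -> 'I_N, forall j, E (r i + r j) (r (f j)).
  apply: (@fin_all_exists _ _ (fun j k => E (r i + r j) (r k))) => j.
  exact/rcover/AD.
have [add addE] := @fin_all_exists _ _ (fun i f => forall j, E (r i + r j) (r (f j))) ex_add.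
have [z zE] := rcover A0; rewrite -/(E _ _) in zE.
have EDI x y w : E (x + w) (y + w) -> E x y.
  by move=> /ED/(_ (Exx (- w))); rewrite !addrK.
have add_inj i : injective (add i).
  move=> j k eq_jk; apply: rinj; rewrite -[B _]/(E _ _).
  apply: (EDI (r j) (r k) (r i)); rewrite ![_ + r i]addrC.
  by apply: Etrans (addE i j) _; rewrite eq_jk; apply: Esym.
pose t i := perm (@add_inj i).
have tX i m k : E (r i *+ m + r k) (r ((t i ^+ m)%g k)).
  elim: m k => [|m IHm] k; first by rewrite mulr0n add0r expg0 perm1.
  rewrite expgS permM permE mulrSr -addrA; apply: Etrans (IHm _).
  exact: ED.
have tX1 i m : (t i ^+ m)%g = 1%g <-> B (r i *+ m).
  split=> [t1 | Bm].
    by have := tX i m i; rewrite t1 perm1 /E addrK.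
  apply/permP=> k; rewrite perm1; apply/esym/rinj; apply: Etrans (tX i m k).
  by rewrite -[X in E X _]add0r; apply: ED => //; apply/Esym/Er0.
have tM i j : (t i * t j)%g = t (add i j).
  apply/permP=> k; rewrite permM !permE; apply: rinj; rewrite -[B _]/(E _ _).
  apply: Etrans (addE _ _); apply: Esym; apply: Etrans (addE j _).
  apply: (@Etrans (r j + (r i + r k))); last exact: ED.
  by rewrite addrA; apply: ED => //; apply: Esym; rewrite addrC.
have tinj : injective t.
  move=> i j /permP/(_ z); rewrite !permE => eq_ij; apply: rinj; rewrite -[B _]/(E _ _).
  apply: (EDI (r i) (r j) (r z)).
  by apply: Etrans (addE i z) _; rewrite eq_ij; apply: Esym.
have t_group : group_set [set t i | i : 'I_N].
  apply/group_setP; split=> [|_ _ /imsetP[i _ ->] /imsetP[j _ ->]].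
    apply/imsetP; exists z => //; apply/esym/permP=> k; rewrite permE perm1.
    apply/esym/rinj; apply: Etrans (addE z k).
    by rewrite -[X in E X _]add0r; apply: ED.
  by rewrite tM; apply: imset_f.
pose G := Group t_group.
have cardG : #|G| = N by rewrite card_imset // card_ord.
split=> [|[x [Ax nBx Bpx]]].
  (* By Cauchy's theorem some translation [t i] has order [p]; then [r i] is the element sought. *)
  rewrite -{1}cardG => /(Cauchy p_pr)[_ /imsetP[i _ ->] ti_p].
  exists (r i); split=> // [Bi|].
    have /tX1 : B (r i *+ 1) by rewrite mulr1n.
    by rewrite expg1 => t1; rewrite t1 order1 in ti_p; rewrite -ti_p in p_pr.
  by apply/tX1; rewrite -ti_p expg_order.
(* Conversely, translation by the representative of [x] is nontrivial with trivial [p]-th power, so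
   its order is [p], which divides the order of the group. *)
have [i Bi] := rcover Ax; rewrite -/(E _ _) in Bi.
have nBri : ~ B (r i) by move=> /Er0 Bri; apply/nBx/Er0; apply: Etrans Bri.
have ti1 : t i != 1%g.
  by apply/eqP=> t1; apply: nBri; rewrite -[r i]mulr1n; apply/tX1; rewrite expg1.
have /tX1 tp : B (r i *+ p).
  have Em m : E (x *+ m) (r i *+ m).
    by elim: m => [|m IHm]; rewrite ?mulr0n ?mulrS //; apply: ED.
  by apply/Er0; apply: Etrans (Esym (Em p)) _; apply/Er0.
have -> : p = #[t i]%g.
  apply/esym/(prime_nt_dvdP p_pr); first by rewrite order_eq1.
  by rewrite order_dvdn tp.
by have := order_dvdG (imset_f t (erefl : i \in (fun=> true)) : t i \in G); rewrite cardG.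
Qed.

End Cosets.

(** * Irreducible factors, algebraic integers and reduction modulo [p] *)

(** Irreducibility is decidable over a finite field, so induction on the size applies: a reducible
    [c] has a nonconstant divisor of smaller size. *)
Lemma exists_irreducible_dvdp (F : finFieldType) (c : {poly F}) :
  (1 < size c)%N -> exists2 q : {poly F}, irreducible_poly q & q %| c.
Proof.
have [m] := ubnP (size c); elim: m c => // m IHm c /ltnSE le_cm c_gt1.
have [|c_red] := boolP (irreducibleb c); first by move/irreducibleP; exists c.
move: c_red; rewrite /irreducibleb c_gt1 /= negb_forall => /existsP[q].
rewrite negb_imply -ltnNge => /andP[q_c q_gt1].
have [|//|d d_irr d_q] := IHm q.
  apply: leq_trans le_cm; have := size_npoly q; rewrite -ltnS.
  by rewrite prednK // ltnW.
exists d => //; apply: dvdp_trans d_q _.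
by rewrite dvdpE.
Qed.

Lemma size_map_intr (R : numDomainType) (g : {poly int}) :
  size (map_poly (intr : int -> R) g) = size g.
Proof. exact: size_map_inj_poly intr_inj (mulr0z 1) _. Qed.

(** The minimal polynomial of an algebraic integer is the required monic equation. This form gives
    access to the integrality of roots of monic polynomials with integral coefficients. *)
Lemma Aint_integralP (x : algC) :
  x \in Aint <-> integralOver (intr : int -> algC) x.
Proof.
split=> [|[q q_mon qx0]].
  rewrite unfold_in => /floorpP[q Dq]; exists q; last by rewrite -Dq root_minCpoly.
  have := minCpoly_monic x; rewrite Dq !monicE.
  by rewrite (lead_coef_map_inj (@intr_inj algC) (mulr0z 1)) (eqr_int _ _ 1).
apply: root_monic_Aint qx0 _ _; first exact: monic_map.
by apply/polyOverP=> i; rewrite coef_map /= intr_int.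
Qed.

Lemma irredp_dvd_exp (F : fieldType) (q g : {poly F}) k :
  irreducible_poly q -> q %| g ^+ k -> q %| g.
Proof.
move=> q_irr; apply: contraLR; rewrite -!irreducible_poly_coprime //.
exact: coprimep_expr.
Qed.

Definition redp (p : nat) : {rmorphism {poly int} -> {poly 'F_p}} :=
  map_poly (intr : int -> 'F_p).

(** Membership in the square of the ideal [(p, q)] of Z[X], written on the generators [q^2], [p q],
    [p^2]. The ideal is maximal when [q] is irreducible modulo the prime [p]. *)
Definition in_ideal_sq (p : nat) (q g : {poly int}) :=
  exists u v w, g = q ^+ 2 * u + p%:R * q * v + p%:R ^+ 2 * w.

Section Reduction.

Variable p : nat.
Hypothesis p_pr : prime p.

Lemma redp_p : redp p p%:R = 0.
Proof. by rewrite rmorph_nat -polyC_natr (pchar_Fp_0 p_pr). Qed.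

Lemma redp_eq0 (g : {poly int}) : redp p g = 0 -> exists h, g = p%:R * h.
Proof.
move=> /polyP g0; exists (map_poly (divz^~ p) g); apply/polyP=> i.
rewrite -polyC_natr coefCM coef_map_id0 ?div0z // natz mulrC divzK //.
by rewrite (dvdz_pcharf (pchar_Fp p_pr)); have := g0 i; rewrite coef_map coef0 => ->.
Qed.

Lemma redp_surj (g : {poly 'F_p}) : exists h, redp p h = g.
Proof.
exists (map_poly (fun x : 'F_p => (x : nat)%:Z) g); apply/polyP=> i.
by rewrite coef_map coef_map_id0 //= -pmulrn natr_Zp.
Qed.

(** Divisibility modulo [p] is membership in the ideal [(p, q)]: lift the cofactor to Z[X]; the
    difference is a multiple of [p]. *)
Lemma redp_dvdP (q g : {poly int}) :
  redp p q %| redp p g <-> exists u v, g = q * u + p%:R * v.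
Proof.
split=> [/dvdpP[c Dg] | [u [v ->]]].
  have [u Du] := redp_surj c.
  have /redp_eq0[v Dv] : redp p (g - q * u) = 0.
    by rewrite rmorphB rmorphM Du Dg mulrC subrr.
  by exists u, v; rewrite -Dv addrC subrK.
by rewrite rmorphD !rmorphM redp_p mul0r addr0 dvdp_mulr.
Qed.

End Reduction.

(** * Dedekind's criterion for Z[theta] *)

Section Generator.

Variables (f : {poly int}) (theta : algC).
Hypothesis f_monic : f \is monic.
Hypothesis f_irr : irreducible_poly (map_poly (intr : int -> rat) f).
Hypothesis f_root : root (map_poly (intr : int -> algC) f) theta.

Let ev : {rmorphism {poly int} -> algC} := horner_eval theta \o map_poly intr.

Let evE g : (map_poly intr g).[theta] = ev g.
Proof. by []. Qed.

Let evf : ev f = 0.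
Proof. exact/eqP. Qed.

Let evZ c g : ev (c *: g) = c%:~R * ev g.
Proof. by rewrite /ev /= /horner_eval map_polyZ hornerZ. Qed.

(** Division by the monic [f] stays over the integers. A nonzero remainder has smaller degree, so it
    is coprime to the irreducible [f] over the rationals and cannot share the root [theta]. *)
Lemma root_int_dvd (g : {poly int}) :
  root (map_poly (intr : int -> algC) g) theta -> exists m, g = m * f.
Proof.
rewrite {1}(Pdiv.RingMonic.rdivp_eq f_monic g).
set q := Pdiv.Ring.rdivp _ _; set r := Pdiv.Ring.rmodp _ _ => /eqP.
rewrite evE (rmorphD ev) (rmorphM ev) evf mulr0 add0r => evr.
exists q; rewrite [LHS](Pdiv.RingMonic.rdivp_eq f_monic g) -/q -/r.
suff -> : r = 0 by rewrite addr0.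
apply/eqP/negPn/negP=> r_n0.
have rQ h : map_poly (intr : int -> algC) h
          = map_poly ratr (map_poly (intr : int -> rat) h).
  by rewrite -map_poly_comp; apply: eq_map_poly => z /=; rewrite ratr_int.
have : coprimep (map_poly (intr : int -> algC) f) (map_poly intr r).
  rewrite !rQ coprimep_map irreducible_poly_coprime //.
  apply/negP=> /dvdp_leq; rewrite map_poly_eq0_id0; last first.
    by rewrite intr_eq0 lead_coef_eq0.
  move=> /(_ r_n0); rewrite !size_map_intr.
  by rewrite leqNgt Pdiv.Ring.ltn_rmodpN0 // monic_neq0.
by move/coprimep_root/(_ f_root); rewrite evE evr eqxx.
Qed.

(** Multiply a monic integer equation of degree [k] for [x] by [s(theta)^k] and replace [s(theta) x]
    by [t(theta)]: then [t^k] plus a multiple of [s] vanishes at [theta], hence is a multiple of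
    [f]. *)
Lemma integral_quotient_dvd (s t : {poly int}) (x : algC) :
    x \in Aint -> (map_poly intr s).[theta] * x = (map_poly intr t).[theta] ->
  exists k u v, t ^+ k = s * u + f * v.
Proof.
move=> /Aint_integralP[P P_mon /rootP Px0]; rewrite !evE => sx_t.
have [k sizeP] : exists k, size P = k.+1.
  by exists (size P).-1; rewrite prednK // lt0n size_poly_eq0 monic_neq0.
(* The terms of [s^k P(t/s)] below the leading one, divided by [s]. *)
pose u := \sum_(i < k) P`_i *: (t ^+ i * s ^+ (k - i.+1)).
suff /root_int_dvd[v Dv] : root (map_poly (intr : int -> algC) (t ^+ k + s * u)) theta.
  by exists k, (- u), v; rewrite mulrN addrC mulrC -Dv addrK.
apply/eqP; rewrite evE.
have -> : t ^+ k + s * u = \sum_(i < k.+1) P`_i *: (t ^+ i * s ^+ (k - i)).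
  rewrite big_ord_recr /= subnn mulr1 addrC /u mulr_sumr; congr (_ + _).
    by move: P_mon; rewrite monicE /lead_coef sizeP => /eqP->; rewrite scale1r.
  by apply: eq_bigr => i _; rewrite -scalerAr mulrCA -exprS subnSK.
transitivity (ev s ^+ k * (map_poly intr P).[x]); last by rewrite Px0 mulr0.
rewrite rmorph_sum horner_coef.
rewrite size_map_intr sizeP mulr_sumr.
apply: eq_bigr => i _; rewrite coef_map evZ (rmorphM ev) !(rmorphXn ev) -sx_t.
have -> : ev s ^+ k = ev s ^+ i * ev s ^+ (k - i).
  by rewrite -exprD subnKC // -ltnS.
by rewrite exprMn /=; ring.
Qed.

Lemma Aint_horner_int (g : {poly int}) : (map_poly intr g).[theta] \in Aint.
Proof.
have theta_int : theta \in Aint by apply/Aint_integralP; exists f.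
rewrite horner_coef; apply: rpred_sum => i _.
by rewrite coef_map rpredM ?rpredX // Aint_int.
Qed.

(* Uchida's form of Dedekind's criterion: if f = q^2 u + p q v + p^2 w, then
   x = (q u + p v)(theta) / p is a root of X^2 - v(theta) X + (u w)(theta). *)
Lemma prime_dvd_index (p N : nat) : prime p -> is_index theta N ->
  (p %| N)%N <->
  exists q, irreducible_poly (redp p q) /\ in_ideal_sq p q f.
Proof.
move=> p_pr [r [rZK rcover rinj]].
have p_n0 : p%:R != 0 :> algC by rewrite pnatr_eq0 -lt0n prime_gt0.
have evZK g : inZK theta (ev g).
  split; last exact: Aint_horner_int.
  exists (map_poly intr g); rewrite -map_poly_comp; congr (_.[_]).
  by apply: eq_map_poly => z /=; rewrite ratr_int.
have fp_n0 : redp p f != 0 by rewrite monic_neq0 ?monic_map.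
have B0 : inZtheta theta 0 by exists 0; rewrite map_poly0 horner0.
have BB x y : inZtheta theta x -> inZtheta theta y -> inZtheta theta (x - y).
  by move=> [g ->] [h ->]; exists (g - h); rewrite !evE rmorphB.
have A0 : inZK theta 0 by have := evZK 0; rewrite rmorph0.
have AD x y : inZK theta x -> inZK theta y -> inZK theta (x + y).
  move=> [[g ->] xZ] [[h ->] yZ]; split; last exact: rpredD.
  by exists (g + h); rewrite rmorphD hornerD.
rewrite (prime_dvd_index_cosets A0 AD B0 BB rZK rcover rinj p_pr).
split=> [[x [[_ x_int] xB [g Dg]]] | [q [q_irr [u [v [w Df]]]]]].
  rewrite evE -mulr_natl in Dg.
  (* Otherwise [g = f u + p v], and [x = v(theta)] would lie in Z[theta]. *)
  have nf_g : ~~ (redp p f %| redp p g).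
    apply/negP=> /(redp_dvdP p_pr)[u [v Dg']]; apply: xB; exists v.
    apply: (mulfI p_n0); rewrite evE Dg Dg' (rmorphD ev) (rmorphM ev f).
    by rewrite evf mul0r add0r (rmorphM ev) (rmorph_nat ev).
  (* With [d] the gcd of [f] and [g] modulo [p], write [f = c d], where [c] is not constant, and
     [c = e q'] with [q'] irreducible. Then [e d] lifts to a combination [h] of [f] and [g], so
     [f = q h] modulo [p], and [h(theta) / p] is again integral. *)
  have [[u1 u2]] := Bezoutp (redp p f) (redp p g).
  rewrite [_.1]/= [_.2]/=; set d := _ + _ => d_gcd.
  have /dvdpP[c Dc] : d %| redp p f by rewrite (eqp_dvdl _ d_gcd) dvdp_gcdl.
  have d_g : d %| redp p g by rewrite (eqp_dvdl _ d_gcd) dvdp_gcdr.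
  have c_gt1 : (1 < size c)%N.
    rewrite ltnNge; apply: contra nf_g => /size1_polyC Dc0.
    rewrite Dc Dc0 mul_polyC; apply: dvdp_trans d_g.
    by rewrite dvdpZl //; apply: contraNneq fp_n0 => c0; rewrite Dc Dc0 c0 mul0r.
  have [q' q_irr /dvdpP[e De]] := exists_irreducible_dvdp c_gt1.
  have [q Dq] := redp_surj q'.
  have [e1 De1] := redp_surj (e * u1).
  have [e2 De2] := redp_surj (e * u2).
  have [h Eh] : exists h, h = e1 * f + e2 * g by exists (e1 * f + e2 * g).
  have Dh : redp p h = e * d.
    by rewrite Eh rmorphD !rmorphM De1 De2 /d mulrDr !mulrA.
  have /(redp_eq0 p_pr)[k Dk] : redp p (f - q * h) = 0.
    by rewrite rmorphB rmorphM Dh Dc De Dq; ring.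
  have q_f : redp p q %| redp p f by rewrite Dq Dc De mulrAC dvdp_mull.
  pose y := ev e2 * x.
  have y_int : y \in Aint by rewrite rpredM ?Aint_horner_int.
  have Dy : p%:R * y = ev h.
    rewrite mulrCA Dg Eh (rmorphD ev) (rmorphM ev e1) (rmorphM ev e2) evf.
    by rewrite mulr0 add0r.
  have Dqy : ev q * y = ev (- k).
    apply: (mulfI p_n0); rewrite mulrCA Dy -(rmorphM ev).
    have -> : q * h = f - p%:R * k by rewrite -Dk; ring.
    by rewrite (rmorphB ev) evf (rmorphM ev) (rmorphN ev) (rmorph_nat ev); ring.
  (* Since [p y = h(theta)] with [y] integral, a power of [h] lies in [(p, f)]; modulo [p] the
     irreducible [q] divides [f], hence [h]. *)
  have /(redp_dvdP p_pr)[a [b Dhq]] : redp p q %| redp p h.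
    have [|m [a [b /(congr1 (redp p)) Dhm]]] := @integral_quotient_dvd p%:R h y y_int.
      by rewrite !evE rmorph_nat.
    rewrite rmorphXn rmorphD !rmorphM in Dhm.
    rewrite (redp_p p_pr) mul0r add0r in Dhm.
    apply: (@irredp_dvd_exp _ _ _ m); first by rewrite Dq.
    by rewrite Dhm dvdp_mulr.
  (* Likewise [q(theta) y = - k(theta)] puts a power of [- k] in [(q, f)]. Thus in [f = q h + p k]
     both [h] and [k] lie in [(p, q)]. *)
  have /(redp_dvdP p_pr)[a' [b' Dkq]] : redp p q %| redp p k.
    have [//|m [s [t /(congr1 (redp p)) Dkm]]] := @integral_quotient_dvd q (- k) y y_int.
    rewrite rmorphXn rmorphD !rmorphM rmorphN in Dkm.
    rewrite -dvdpNr; apply: (@irredp_dvd_exp _ _ _ m); first by rewrite Dq.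
    by rewrite Dkm dvdp_add // dvdp_mulr.
  exists q; rewrite Dq; split=> //; exists a, (b + a'), b'.
  rewrite -[f](subrK (q * h)) Dk Dkq Dhq; ring.
pose h := q * u + p%:R * v; pose x := ev h / p%:R.
have Dx : x *+ p = ev h by rewrite -mulr_natr divfK.
exists x; split; last by exists h; rewrite Dx.
  split.
    have [[g Dg] _] := evZK h; exists (p%:R^-1 *: g).
    by rewrite map_polyZ hornerZ /= -Dg fmorphV rmorph_nat mulrC.
  apply/Aint_integralP.
  pose P := Poly [:: ev u * ev w; - ev v; 1].
  have DP : P = [:: ev u * ev w; - ev v; 1] :> seq algC by rewrite (@PolyK _ 0) //= oner_neq0.
  apply: (@integral_root_monic _ _ _ _ P).
  - by rewrite monicE /lead_coef DP.
  - have Dqh : ev q * ev h = - (p%:R ^+ 2 * ev w).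
      have : ev (q * h) = ev (f - p%:R ^+ 2 * w) by rewrite Df /h; congr (ev _); ring.
      rewrite (rmorphM ev) (rmorphB ev) evf (rmorphM ev _ w) (rmorphXn ev).
      by rewrite (rmorph_nat ev) add0r.
    have Dh : ev h - p%:R * ev v = ev u * ev q.
      rewrite /h (rmorphD ev) (rmorphM ev q) (rmorphM ev _ v) (rmorph_nat ev).
      by rewrite addrK mulrC.
    apply/eqP; have -> : P.[x] = x ^+ 2 - ev v * x + ev u * ev w.
      by rewrite horner_Poly /=; ring.
    apply: (mulfI (expf_neq0 2 p_n0)); rewrite mulr0.
    transitivity (ev h * (ev h - p%:R * ev v) + p%:R ^+ 2 * (ev u * ev w)).
      by rewrite /x; field.
    by rewrite Dh mulrCA [_ * ev q]mulrC Dqh; ring.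
  move=> c; rewrite DP !inE => /or3P[] /eqP->; last exact: integral1.
    by apply/Aint_integralP; rewrite rpredM ?Aint_horner_int.
  by apply/Aint_integralP; rewrite rpredN; apply: Aint_horner_int.
(* If [x] were in Z[theta], then modulo [p] the polynomial [h = q u] would be a multiple of
   [f = q^2 u], making [q] a unit. *)
case=> g; rewrite evE => Dg.
have /root_int_dvd[m Dm] : root (map_poly (intr : int -> algC) (h - p%:R * g)) theta.
  apply/eqP; rewrite evE (rmorphB ev) (rmorphM ev) (rmorph_nat ev) -Dg.
  by rewrite mulrC divfK // subrr.
move/(congr1 (redp p)): Dm; rewrite rmorphB !rmorphM (redp_p p_pr) mul0r subr0.
move/(congr1 (redp p)): Df; rewrite !rmorphD !rmorphM (redp_p p_pr).
rewrite !mul0r !addr0 => {}Df Dm.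
have quf_n0 : redp p q * redp p u != 0.
  by apply: contraNneq fp_n0 => qu0; rewrite Df -mulrA qu0 mulr0.
have /(mulfI quf_n0) qm1 : redp p q * redp p u * 1
    = redp p q * redp p u * (redp p m * redp p q).
  by rewrite mulr1 {1}Dm Df; ring.
have : redp p q %| 1 by rewrite qm1 dvdp_mull.
by rewrite dvdp1; case: q_irr => /gtn_eqF/= ->.
Qed.

End Generator.

(** * Resultants and the discriminant of [fpoly n a] *)

(* The Sylvester matrix is multiplied by the matrix whose first columns are
   those of the identity and whose last columns are the powers of the roots. *)
Lemma resultant_roots (R : idomainType) (p q : {poly R}) (t : 'I_(size p).-1 -> R) :
    injective t -> (forall i, root p (t i)) ->
  resultant p q * (\prod_i t i) ^+ (size q).-1
    = p`_0 ^+ (size q).-1 * \prod_i q.[t i].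
Proof.
set dp := (size p).-1 in t *; set dq := (size q).-1 => t_inj pt0.
have [S DS] : exists S : 'M_(dq + dp), S = Sylvester_mx p q by exists (Sylvester_mx p q).
have S_l k j : S (lshift dp k) j = p`_(j - k) *+ (k <= j).
  by rewrite DS Sylvester_mxE (unsplitK (inl k)).
have S_r k j : S (rshift dq k) j = q`_(j - k) *+ (k <= j).
  by rewrite DS Sylvester_mxE (unsplitK (inr k)).
have Dres : resultant p q = \det S by rewrite DS.
pose tr := \row_i t i.
pose V := Vandermonde dp tr; pose W := Vandermonde (dq + dp) tr.
have V_n0 : \det V != 0.
  rewrite det_Vandermonde; apply/prodf_neq0 => i _; apply/prodf_neq0 => j lt_ij.
  by rewrite !mxE subr_eq0 (inj_eq t_inj) neq_ltn lt_ij orbT.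
(* The coefficients are those of [X^k g], as in a row of the Sylvester matrix; the guard [k <= j]
   corrects the truncated subtraction. *)
have band_horner (g : {poly R}) k x : (size g + k <= dq + dp)%N ->
    \sum_(j < dq + dp) g`_(j - k) *+ (k <= j) * x ^+ j = x ^+ k * g.[x].
  move=> le_g; rewrite -[x ^+ k]hornerXn -hornerM [RHS](@horner_coef_wide _ (dq + dp)).
    by apply: eq_bigr => j _; rewrite coefXnM ltnNge if_neg mulrb.
  apply: leq_trans (size_polyMleq _ _) _.
  by rewrite size_polyXn addSn /= addnC.
have SW : S *m W = col_mx 0 (V *m diag_mx (\row_i q.[t i])).
  apply/matrixP=> i j; rewrite mxE.
  case: (split_ordP i) => k ->; rewrite ?col_mxEu ?col_mxEd.
    under eq_bigr do rewrite S_l !mxE.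
    rewrite band_horner ?mxE; first by rewrite (rootP (pt0 j)) mulr0.
    apply: leq_trans (leq_add (leqSpred _) (leqnn k)) _.
    by rewrite -/dp addSnnS addnC leq_add2r.
  under eq_bigr do rewrite S_r !mxE.
  rewrite band_horner ?mul_mx_diag ?mxE //.
  apply: leq_trans (leq_add (leqSpred _) (leqnn k)) _.
  by rewrite -/dq addSnnS leq_add2l.
have W_dn : dsubmx W = V *m diag_mx (\row_i t i ^+ dq).
  by apply/matrixP=> i j; rewrite mul_mx_diag !mxE /= exprD mulrC.
have SE : S *m col_mx 1%:M 0 = col_mx (ulsubmx S) (dlsubmx S).
  by rewrite -{1}[S]submxK mul_block_col !mulmx1 !mulmx0 !addr0.
have det_S_ul : \det (ulsubmx S) = p`_0 ^+ dq.
  rewrite -det_tr det_trig.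
    rewrite -[dq in RHS]card_ord -prodr_const.
    by apply: eq_bigr => i _; rewrite !mxE S_l /= subnn leqnn.
  by apply/is_trig_mxP=> i j lt_ij; rewrite !mxE S_l /= leqNgt lt_ij.
(* Both determinants contain the factor [\det V], nonzero because the roots are distinct, and it
   cancels. *)
have := det_mulmx S (row_mx (col_mx 1%:M 0) W).
rewrite mul_mx_row SE SW -block_mxEh det_lblock det_S_ul.
rewrite -[W]vsubmxK -block_mxEh det_ublock det1 mul1r W_dn !det_mulmx !det_diag.
under eq_bigr do rewrite mxE; under [in RHS]eq_bigr do rewrite mxE.
by rewrite prodrXl Dres mulrCA [RHS]mulrCA => /(mulfI V_n0).
Qed.

Lemma resultant_map_intr (R : numDomainType) (p q : {poly int}) :
  (resultant p q)%:~R = resultant (map_poly (intr : int -> R) p) (map_poly intr q).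
Proof.
rewrite /resultant /Sylvester_mx !size_map_intr -det_map_mx /= map_col_mx.
by congr (\det (col_mx _ _)); apply: map_lin1_mx => v;
  rewrite map_poly_rV rmorphM /= map_rVpoly.
Qed.

Lemma irreducible_separable (F : numFieldType) (p : {poly F}) :
  irreducible_poly p -> separable_poly p.
Proof.
move=> p_irr; have p_n0 := irredp_neq0 p_irr.
rewrite unlock irreducible_poly_coprime //; apply/negP=> /dvdp_leq.
have [p_gt1 _] := p_irr.
have -> : p^`() != 0.
  apply/eqP=> /polyP/(_ (size p).-2); rewrite coef_deriv coef0 => /eqP.
  rewrite -[_.-2.+1]/(_.-1.-1.+1) prednK; last by rewrite -ltnS prednK // ltnW.
  rewrite mulrn_eq0 -/(lead_coef p) lead_coef_eq0 (negPf p_n0).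
  by rewrite -leqn0 leqNgt -ltnS prednK ?p_gt1 // ltnW.
by move=> /(_ isT); rewrite leqNgt lt_size_deriv.
Qed.

Lemma fpoly_monic_size n a : (0 < n)%N ->
  fpoly n a \is monic /\ size (fpoly n a) = n.*2.+1.
Proof.
move=> n_gt0; have n2 : (n < n.*2)%N by rewrite -addnn -[n in (n < _)%N]addn0 ltn_add2l.
have q_mon : ('X ^+ 2 + 1 : {poly int}) ^+ n \is monic.
  by rewrite monic_exp // monicE lead_coefDl ?lead_coefXn // size_polyXn size_poly1.
have q_size : size (('X ^+ 2 + 1 : {poly int}) ^+ n) = n.*2.+1.
  rewrite -[LHS]prednK ?lt0n ?size_poly_eq0 ?monic_neq0 //.
  by rewrite size_exp (size_XnaddC 1) // mul2n.
have le_size : (size (- (a%:P * 'X ^+ n) : {poly int})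
    < size (('X ^+ 2 + 1 : {poly int}) ^+ n))%N.
  rewrite q_size size_polyN mul_polyC; apply: leq_ltn_trans (size_scale_leq _ _) _.
  by rewrite size_polyXn ltnS.
by rewrite monicE /fpoly lead_coefDl // size_polyDl // q_size -monicE.
Qed.

Lemma horner_fpoly n a (R : comNzRingType) (x : R) :
  (map_poly intr (fpoly n a)).[x] = (x ^+ 2 + 1) ^+ n - a%:~R * x ^+ n.
Proof.
rewrite /fpoly rmorphB rmorphM /= map_polyC rmorphXn rmorphD /= rmorph1.
by rewrite !map_polyXn -polyC1 !(hornerD, hornerN, hornerCM, horner_exp, hornerX, hornerC).
Qed.

Lemma deriv_fpoly n a : (0 < n)%N ->
  ('X ^+ 2 + 1) * (fpoly n a)^`() =
    (n%:R * a%:P) * 'X ^+ n.-1 * ('X ^+ 2 - 1) + n.*2%:R * 'X * fpoly n a.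
Proof.
case: n => // n _; rewrite /fpoly !derivE deriv_exp !derivE /=.
rewrite !exprS -mul2n natrM; ring.
Qed.

Lemma horner_deriv_fpoly n a (R : comNzRingType) (x : R) : (0 < n)%N ->
  (x ^+ 2 + 1) * ((map_poly intr (fpoly n a))^`()).[x] =
    (n%:R * a%:~R) * x ^+ n.-1 * (x ^+ 2 - 1)
    + n.*2%:R * x * (map_poly intr (fpoly n a)).[x].
Proof.
move/(deriv_fpoly a); rewrite deriv_map; move: (fpoly n a) (fpoly n a)^`() => g g'.
move/(congr1 (fun h => (map_poly (intr : int -> R) h).[x])).
rewrite rmorphM rmorphD [in RHS]rmorphD !rmorphM rmorphB !rmorphXn !rmorph1 !rmorph_nat /=.
rewrite !map_polyX map_polyC -!polyC_natr -polyC1.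
by rewrite !(hornerM, hornerD, hornerN, hornerX, hornerXn, hornerC).
Qed.

(** The resultant is the product of [f'(z)] over the roots [z]. At a root,
    [(z^2 + 1) f'(z) = n a z^(n-1) (z^2 - 1)], and the products of [z^2 + 1], [z] and [z^2 - 1] are
    read off from the values of [f] at the square roots of -1, at 0 and at 1 and -1. *)
Lemma disc_fpoly n a : (0 < n)%N -> a != 0 ->
    irreducible_poly (map_poly (intr : int -> rat) (fpoly n a)) ->
  disc (fpoly n a) = (-1) ^+ n * n%:R ^+ n.*2 * a ^+ (n.*2 - 2)
    * (2 ^+ n - a) * (2 ^+ n - (- 1) ^+ n * a).
Proof.
move=> n_gt0 a_n0 f_irr; have [f_mon f_size] := fpoly_monic_size a n_gt0.
have n_gt1 : (1 < n.*2)%N by case: (n) n_gt0.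
have sgn_n : (-1) ^+ 'C(n.*2, 2) = (-1) ^+ n :> int.
  rewrite bin2 -doubleMl doubleK -signr_odd oddM.
  by rewrite -[in RHS]signr_odd; case: (n) n_gt0 => // m _;
    rewrite doubleS /= odd_double andbT.
rewrite /disc f_size [_.-1]/= (eqP f_mon) divz1 sgn_n -!mulrA; congr (_ * _).
set g := fpoly n a in f_irr f_mon f_size *.
pose F := map_poly (intr : int -> algC) g.
have F_mon : F \is monic by apply: monic_map.
have F_size : size F = n.*2.+1 by rewrite size_map_intr.
have F_sep : separable_poly F.
  have -> : F = map_poly ratr (map_poly (intr : int -> rat) g).
    by rewrite -map_poly_comp; apply: eq_map_poly => z /=; rewrite ratr_int.
  by rewrite separable_map irreducible_separable.
have [r DF] := closed_field_poly_normal F.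
rewrite (eqP F_mon) scale1r in DF.
have r_size : size r = n.*2.
  by apply: succn_inj; rewrite -F_size DF size_prod_XsubC.
have r_uniq : uniq r by rewrite -separable_prod_XsubC -DF.
(* The number [2n] of roots is even, so reversing each difference costs no sign. *)
have prod_r x : \prod_(z <- r) (z - x) = F.[x].
  rewrite DF horner_prod; under [RHS]eq_bigr do rewrite hornerXsubC -opprB -mulN1r.
  by rewrite big_split /= big_const_seq count_predT iter_mulr_1 r_size
    -mul2n exprM sqrrN !expr1n mul1r.
have F_horner x : F.[x] = (x ^+ 2 + 1) ^+ n - a%:~R * x ^+ n by apply: horner_fpoly.
have F0 : F.[0] = 1 by rewrite F_horner !expr0n add0r expr1n eqn0Ngt n_gt0 mulr0 subr0.
have prod_r1 : \prod_(z <- r) z = 1.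
  by rewrite -[RHS]F0 -prod_r; apply: eq_bigr => z _; rewrite subr0.
have rootF z : z \in r -> root F z by rewrite DF root_prod_XsubC.
(* Here [f(0) = 1] and the product of the roots is 1, so both correcting powers in [resultant_roots]
   disappear. *)
have resE : (resultant g g^`())%:~R = \prod_(z <- r) (F^`()).[z].
  rewrite resultant_map_intr -deriv_map -/F.
  pose t (i : 'I_(size F).-1) := r`_i.
  have big_t (G : algC -> algC) : \prod_i G (t i) = \prod_(z <- r) G z.
    have sz : size r = (size F).-1 by rewrite F_size r_size.
    by rewrite (big_nth 0) sz big_mkord.
  have lt_r (i : 'I_(size F).-1) : (i < size r)%N.
    by have := ltn_ord i; rewrite [X in (_ < X.-1)%N]F_size r_size.
  have t_inj : injective t.
    move=> i j /eqP; rewrite /t nth_uniq ?lt_r // => /eqP; apply: val_inj.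
  have t_root i : root F (t i).
    by apply: rootF; rewrite mem_nth ?lt_r.
  have := resultant_roots F^`() t_inj t_root.
  rewrite (big_t id) (big_t (horner F^`())).
  by rewrite prod_r1 -horner_coef0 F0 !expr1n mulr1 mul1r.
have prod_f' : \prod_(z <- r) (F^`()).[z] * a%:~R ^+ 2 =
    (n%:R * a%:~R) ^+ n.*2 * (F.[1] * F.[- 1]).
  (* Only [- a x^n] survives at ['i] and [- 'i], and ['i * - 'i = 1]. *)
  have <- : \prod_(z <- r) (z ^+ 2 + 1) = a%:~R ^+ 2.
    transitivity (F.['i] * F.[- 'i]).
      rewrite -!prod_r -big_split; apply: eq_bigr => z _ /=.
      by rewrite -['i]mulr1 -[1 in LHS]opprK -sqrCi; ring.
    rewrite !F_horner sqrrN sqrCi addNr expr0n eqn0Ngt n_gt0 !sub0r.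
    by rewrite mulrNN mulrACA -exprMn mulrN -['i * 'i]expr2 sqrCi opprK expr1n mulr1.
  rewrite -!prod_r -!big_split /=.
  transitivity (\prod_(z <- r) (n%:R * a%:~R * z ^+ n.-1 * ((z - 1) * (z - -1)))).
    apply: eq_big_seq => z /rootF/rootP Fz0; rewrite mulrC horner_deriv_fpoly //.
    by rewrite -/g -/F Fz0; ring.
  rewrite big_split /= big_split /= prodrXl; congr (_ * _).
  rewrite big_const_seq count_predT iter_mulr_1 r_size.
  by rewrite prod_r1 expr1n mulr1.
have aC_n0 : a%:~R != 0 :> algC by rewrite intr_eq0.
apply: (@intr_inj algC); rewrite resE; apply: (mulIf (expf_neq0 2 aC_n0)).
rewrite prod_f' !F_horner [(_ * _) ^+ n.*2]exprMn.
rewrite !(rmorphM, rmorphB, rmorphXn, rmorphN, rmorph1, rmorph_nat) /=.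
have -> : a%:~R ^+ n.*2 = a%:~R ^+ (n.*2 - 2) * a%:~R ^+ 2 :> algC.
  by rewrite -exprD subnK.
rewrite sqrrN !expr1n; ring.
Qed.

(** * Membership of [fpoly n a] in squares of maximal ideals *)

Section Ideal.

Variable p : nat.
Hypothesis p_pr : prime p.

Lemma redpC (c : int) : redp p c%:P = (c%:~R)%:P.
Proof. by rewrite /= map_polyC. Qed.

Lemma redpX : redp p 'X = 'X.
Proof. exact: map_polyX. Qed.

Lemma redpXn m : redp p ('X ^+ m) = 'X ^+ m.
Proof. exact: map_polyXn. Qed.

Lemma redp_X2D1 : redp p ('X ^+ 2 + 1) = 'X ^+ 2 + 1.
Proof. by rewrite rmorphD redpXn rmorph1. Qed.

Lemma redp_fpoly n a :
  redp p (fpoly n a) = ('X ^+ 2 + 1) ^+ n - (a%:~R)%:P * 'X ^+ n.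
Proof.
by rewrite /fpoly rmorphB rmorphM redpC redpXn rmorphXn redp_X2D1.
Qed.

Lemma dvdz_redp (c : int) : (p %| c)%Z = (c%:~R == 0 :> 'F_p).
Proof. by rewrite (dvdz_pcharf (pchar_Fp p_pr)). Qed.

Lemma in_ideal_sqD q g h :
  in_ideal_sq p q g -> in_ideal_sq p q h -> in_ideal_sq p q (g + h).
Proof.
move=> [u [v [w ->]]] [u' [v' [w' ->]]].
by exists (u + u'), (v + v'), (w + w'); ring.
Qed.

Lemma in_ideal_sqN q g : in_ideal_sq p q g -> in_ideal_sq p q (- g).
Proof.
by move=> [u [v [w ->]]]; exists (- u), (- v), (- w); ring.
Qed.

Lemma in_ideal_sqM q g h :
  redp p q %| redp p g -> redp p q %| redp p h -> in_ideal_sq p q (g * h).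
Proof.
move=> /(redp_dvdP p_pr)[u [v ->]] /(redp_dvdP p_pr)[u' [v' ->]].
by exists (u * u'), (u * v' + v * u'), (v * v'); ring.
Qed.

Lemma in_ideal_sq_dvd q g : in_ideal_sq p q g -> redp p q ^+ 2 %| redp p g.
Proof.
move=> [u [v [w ->]]]; rewrite !rmorphD !rmorphM (redp_p p_pr) !mul0r !addr0.
exact: dvdp_mulr.
Qed.

(** Write [c = p b]. Modulo [p] the coefficient of [q^2] vanishes, so one factor [p] cancels and
    [b X^n] lies in [(p, q)]; as [q] is prime to [X], this forces [p] to divide [b]. *)
Lemma in_ideal_sq_scaleXn q (c : int) n :
    irreducible_poly (redp p q) -> ~~ (redp p q %| 'X) -> (p %| c)%Z ->
  in_ideal_sq p q (c%:P * 'X ^+ n) <-> ((p ^ 2)%:Z %| c)%Z.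
Proof.
have p_n0 : p%:R != 0 :> {poly int}.
  by rewrite -polyC_natr polyC_eq0 natz eqz_nat -lt0n prime_gt0.
move=> q_irr q_X /dvdzP[b ->]; rewrite -mulnn PoszM.
rewrite dvdz_mul2r ?eqz_nat -?lt0n ?prime_gt0 //.
have -> : (b * p%:Z)%:P = p%:R * b%:P by rewrite polyCM -polyC_natr natz mulrC.
split=> [[u [v [w Dg]]] | /dvdzP[b' ->]]; last first.
  by exists 0, 0, (b'%:P * 'X ^+ n); rewrite polyCM -polyC_natr natz; ring.
have /(redp_eq0 p_pr)[u' Du] : redp p u = 0.
  have := congr1 (redp p) Dg; rewrite !rmorphD !rmorphM (redp_p p_pr).
  rewrite !mul0r !addr0 => /esym/eqP.
  by rewrite -mulrA !mulf_eq0 (negPf (irredp_neq0 q_irr)) => /eqP.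
have Db : b%:P * 'X ^+ n = q ^+ 2 * u' + q * v + p%:R * w.
  by apply: (mulfI p_n0); rewrite mulrA Dg Du; ring.
have : redp p q %| redp p (b%:P * 'X ^+ n).
  apply/(redp_dvdP p_pr); exists (q * u' + v), w; rewrite Db; ring.
rewrite rmorphM redpC redpXn dvdz_redp; apply: contraLR => b_n0.
rewrite mul_polyC dvdpZr //; apply: contra q_X; exact: irredp_dvd_exp.
Qed.

(** A common factor with [X] would divide [X^2 + 1], hence 1. *)
Lemma irredp_factor_fpoly n a q : (0 < n)%N ->
    irreducible_poly (redp p q) -> redp p q %| redp p (fpoly n a) ->
  ~~ (redp p q %| 'X).
Proof.
move=> n_gt0 q_irr q_f; apply/negP=> q_X.
have q_1 : redp p q %| 'X ^+ 2 + 1.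
  apply: (irredp_dvd_exp (k := n)) => //; move: q_f; rewrite redp_fpoly.
  by rewrite dvdp_subl // -(prednK n_gt0) exprS mulrCA dvdp_mulr.
have : redp p q %| 1.
  by move: q_1; rewrite dvdp_addr // expr2 dvdp_mulr.
by rewrite dvdp1; case: q_irr => /gtn_eqF/= ->.
Qed.

(** Common frame for the cases where [p] divides [a] or [n]: once [f] may be replaced by [c X^n],
    the choice of [q] is irrelevant, and some [q] exists because [f] is not constant modulo [p]. *)
Lemma fpoly_in_ideal_sq_scaleXn n a (c : int) : (0 < n)%N -> (p %| c)%Z ->
    (forall q, irreducible_poly (redp p q) -> redp p q %| redp p (fpoly n a) ->
       in_ideal_sq p q (fpoly n a - c%:P * 'X ^+ n)) ->
  (exists q, irreducible_poly (redp p q) /\ in_ideal_sq p q (fpoly n a))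
    <-> ((p ^ 2)%:Z %| c)%Z.
Proof.
move=> n_gt0 p_c f_c; split=> [[q [q_irr f_sq]] | p2_c].
  have q_f : redp p q %| redp p (fpoly n a).
    by apply: dvdp_trans (in_ideal_sq_dvd f_sq); rewrite dvdp_exp.
  have q_X := irredp_factor_fpoly n_gt0 q_irr q_f.
  apply/(in_ideal_sq_scaleXn n q_irr q_X p_c).
  rewrite -[_ * _](subKr (fpoly n a)); apply: in_ideal_sqD => //.
  exact/in_ideal_sqN/f_c.
have [f_mon f_size] := fpoly_monic_size a n_gt0.
have f_gt1 : (1 < size (redp p (fpoly n a)))%N.
  by rewrite size_map_poly_id0 ?(eqP f_mon) ?oner_neq0 // f_size; case: (n) n_gt0.
have [q' q_irr q_f] := exists_irreducible_dvdp f_gt1.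
have [q Dq] := redp_surj q'; rewrite -Dq in q_irr q_f.
exists q; split=> //; rewrite -[fpoly n a](subrK (c%:P * 'X ^+ n)).
apply: in_ideal_sqD; first exact: f_c.
by apply/in_ideal_sq_scaleXn => //; apply: irredp_factor_fpoly q_f.
Qed.

(** With [c = - a] the difference is [(X^2 + 1)^n]. Since [n > 1], it splits into two factors, each
    divisible by [q] modulo [p]. *)
Lemma fpoly_in_ideal_sq_dvd_a n a : (1 < n)%N -> (p %| a)%Z ->
  (exists q, irreducible_poly (redp p q) /\ in_ideal_sq p q (fpoly n a))
    <-> ((p ^ 2)%:Z %| a)%Z.
Proof.
move=> n_gt1 p_a; have n_gt0 := ltnW n_gt1.
have Na (d : int) : (d %| - a)%Z = (d %| a)%Z by rewrite !dvdzE abszN.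
rewrite -Na; apply: fpoly_in_ideal_sq_scaleXn; rewrite ?Na //.
move=> q q_irr; rewrite redp_fpoly; move: p_a; rewrite dvdz_redp => /eqP->.
rewrite mul0r subr0 => /(irredp_dvd_exp q_irr) q_1.
have -> : fpoly n a - (- a)%:P * 'X ^+ n = ('X ^+ 2 + 1) * ('X ^+ 2 + 1) ^+ n.-1.
  by rewrite -exprS prednK // /fpoly polyCN; ring.
apply: in_ideal_sqM; rewrite ?rmorphXn redp_X2D1 // -(prednK (_ : 0 < n.-1)%N).
  by rewrite exprS dvdp_mulr.
by case: (n) n_gt1 => [|[]].
Qed.

(** Let [n = m Q] with [Q] the exact power of [p], [y = (X^2 + 1)^m] and [w = a X^m]. Then
    [f - (a^Q - a) X^n = y^Q - w^Q], which is [(y - w)^Q] modulo [p] and has the factor [y - w] over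
    Z. *)
Lemma fpoly_in_ideal_sq_dvd_n n a : (0 < n)%N -> (p %| n)%N ->
  (exists q, irreducible_poly (redp p q) /\ in_ideal_sq p q (fpoly n a))
    <-> ((p ^ 2)%:Z %| a ^+ (p ^ logn p n) - a)%Z.
Proof.
move=> n_gt0 p_n.
have Fk (k : nat) : (a%:~R : 'F_p) ^+ (p ^ k) = a%:~R.
  elim: k => [|k IHk]; first by rewrite expr1.
  by rewrite expnSr exprM IHk -[X in _ ^+ X](card_Fp p_pr) expf_card.
set Q := (p ^ logn p n)%N.
have Q_gt1 : (1 < Q)%N.
  by rewrite -(exp1n (logn p n)) ltn_exp2r ?prime_gt1 // logn_gt0 mem_primes p_pr n_gt0.
have /dvdnP[m Dn] : (Q %| n)%N by apply: pfactor_dvdnn.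
apply: fpoly_in_ideal_sq_scaleXn => //.
  by rewrite dvdz_redp rmorphB rmorphXn /= Fk subrr.
move=> q q_irr q_f.
have [y Dy] : exists y, y = ('X ^+ 2 + 1) ^+ m :> {poly int} by exists (('X ^+ 2 + 1) ^+ m).
have [w Dw] : exists w, w = a%:P * 'X ^+ m :> {poly int} by exists (a%:P * 'X ^+ m).
have frob : redp p y ^+ Q - redp p w ^+ Q = (redp p y - redp p w) ^+ Q.
  rewrite -[redp p y in LHS](subrK (redp p w)) exprDn_pchar ?addrK //.
  rewrite pnatX; apply/orP; left; rewrite pnatE //.
  by rewrite pchar_poly pchar_Fp.
have Df : redp p (fpoly n a) = (redp p y - redp p w) ^+ Q.
  rewrite -frob Dy Dw (rmorphM (redp p) a%:P) redpC rmorphXn redp_X2D1 redpXn.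
  by rewrite exprMn -!exprM -Dn -polyC_exp Fk redp_fpoly.
have [S DyS] : exists S, y ^+ Q - w ^+ Q = (y - w) * S.
  by rewrite subrXX; eexists.
have -> : fpoly n a - (a ^+ Q - a)%:P * 'X ^+ n = (y - w) * S.
  rewrite -DyS Dy Dw exprMn -!exprM -Dn /fpoly polyCB polyC_exp; ring.
have q_yw : redp p q %| redp p y - redp p w.
  by apply: (irredp_dvd_exp (k := Q)) => //; rewrite -Df.
have yw_n0 : redp p y - redp p w != 0.
  have [f_mon _] := fpoly_monic_size a n_gt0.
  have : redp p (fpoly n a) != 0 by rewrite monic_neq0 ?monic_map.
  by rewrite Df; apply: contraNneq => ->; rewrite expr0n gtn_eqF // ltnW.
(* Cancelling [y - w] leaves its power [Q - 1], which is positive, so [q] divides the cofactor [S]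
   too. *)
have RS : redp p S = (redp p y - redp p w) ^+ Q.-1.
  apply: (mulfI yw_n0); rewrite -exprS prednK ?(ltnW Q_gt1) // -frob.
  by rewrite -!rmorphXn -!rmorphB DyS rmorphM.
apply: in_ideal_sqM; rewrite ?rmorphB // RS dvdp_exp //.
by case: (Q) Q_gt1 => [|[]].
Qed.

(** Modulo [p], [q] is associate to [X - e], so [p] divides [q(e)]; evaluate the expression of [g]
    at [e]. *)
Lemma horner_fpoly_in_ideal_sq q g (e : int) :
    irreducible_poly (redp p q) -> redp p q %| 'X - (e%:~R)%:P ->
  in_ideal_sq p q g -> ((p ^ 2)%:Z %| g.[e])%Z.
Proof.
move=> [q_gt1 _] q_e [u [v [w ->]]].
have : redp p q %= 'X - (e%:~R)%:P.
  by have [_] := irredp_XsubC (e%:~R : 'F_p); apply=> //; rewrite gtn_eqF.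
move/eqp_root/(_ e%:~R); rewrite root_XsubC eqxx => /rootP.
rewrite /= horner_map => /eqP; rewrite -dvdz_redp => /dvdzP[b qe].
have pE : (p%:R : {poly int}).[e] = p%:Z by rewrite -polyC_natr hornerC natz.
apply/dvdzP; exists (b ^+ 2 * u.[e] + b * v.[e] + w.[e]).
rewrite -mulnn PoszM !(hornerD, hornerM, horner_exp) qe pE; ring.
Qed.

(** Taylor expansion at [e] to second order: [f(e)] and [f'(e)] are both divisible by [p^2]. *)
Lemma fpoly_in_ideal_sq_XsubC n a (e : int) : (0 < n)%N -> e ^+ 2 = 1 ->
    ((p ^ 2)%:Z %| (fpoly n a).[e])%Z ->
  in_ideal_sq p ('X - e%:P) (fpoly n a).
Proof.
move=> n_gt0 e2 /dvdzP[b Dfe].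
(* At [e] the derivative identity reads [2 f'(e) = 2 n e f(e)]. *)
have f'e : (fpoly n a)^`().[e] = n%:R * e * (fpoly n a).[e].
  have /(congr1 (horner^~ e)) := deriv_fpoly a n_gt0.
  move: (fpoly n a) => g; rewrite -!polyC_natr -polyC1.
  rewrite !(hornerXn, hornerM, hornerD, hornerN, hornerX, hornerC) e2 subrr mulr0 add0r.
  rewrite -mul2n natrM -!mulrA; exact: mulfI.
move: (fpoly n a) Dfe f'e => f Dfe f'e.
have /factor_theorem[k Dk] : root (f - f.[e]%:P) e.
  by rewrite rootE !hornerE subrr.
have /factor_theorem[g Dg] : root (k - k.[e]%:P) e.
  by rewrite rootE !hornerE subrr.
have Df : f = f.[e]%:P + (k.[e]%:P + g * ('X - e%:P)) * ('X - e%:P).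
  by rewrite -Dg [k.[e]%:P + _]addrC subrK -Dk addrC subrK.
have ke : k.[e] = f^`().[e].
  by rewrite {1}Df !derivE !hornerE /= subrr !mulr0 add0r addr0.
have p2E : (b * (p ^ 2)%:Z)%:P = p%:R ^+ 2 * b%:P :> {poly int}.
  by rewrite polyCM -mulnn PoszM polyCM -polyC_natr natz; ring.
exists g, (p%:R * (n%:R * e * b)%:P), b%:P.
rewrite {1}Df ke f'e Dfe.
have -> : (n%:R * e * (b * (p ^ 2)%:Z))%:P = p%:R ^+ 2 * (n%:R * e * b)%:P :> {poly int}.
  by rewrite polyCM p2E !polyCM; ring.
rewrite p2E; ring.
Qed.

Lemma fpoly_in_ideal_sq_coprime n a : (0 < n)%N ->
    ~~ (p %| a)%Z -> ~~ (p %| n)%N ->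
  (exists q, irreducible_poly (redp p q) /\ in_ideal_sq p q (fpoly n a))
    <-> ((p ^ 2)%:Z %| 2 ^+ n - a)%Z \/ ((p ^ 2)%:Z %| 2 ^+ n - (- 1) ^+ n * a)%Z.
Proof.
move=> n_gt0 p_a p_n.
have f1 : (fpoly n a).[1] = 2 ^+ n - a.
  by rewrite /fpoly !hornerE expr1n; congr (_ ^+ n - _); rewrite expr1n mulr1.
have fN1 : (fpoly n a).[- 1] = 2 ^+ n - (- 1) ^+ n * a.
  by rewrite /fpoly !hornerE [a * _]mulrC.
rewrite -f1 -fN1; split=> [[q [q_irr f_sq]] | p2_f]; last first.
  have irr_e (e : int) : irreducible_poly (redp p ('X - e%:P)).
    by rewrite rmorphB redpX redpC; apply: irredp_XsubC.
  case: p2_f => p2_f; [exists ('X - 1%:P) | exists ('X - (- 1)%:P)];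
    by split; [apply: irr_e | apply: fpoly_in_ideal_sq_XsubC].
have q2_f := in_ideal_sq_dvd f_sq.
have q_f : redp p q %| redp p (fpoly n a).
  by apply: dvdp_trans q2_f; rewrite dvdp_exp.
(* Modulo [p] the square of [q] divides [f], so [q] divides the derivative. *)
have q_f' : redp p q %| redp p (fpoly n a)^`().
  have -> : redp p (fpoly n a)^`() = (redp p (fpoly n a))^`() by rewrite /= deriv_map.
  have /dvdpP[c ->] := q2_f.
  rewrite derivM deriv_exp /= expr1 dvdp_add //.
    by rewrite dvdp_mull // dvdp_exp.
  by rewrite dvdp_mull // -mulr_natl mulrA dvdp_mull.
have q_X := irredp_factor_fpoly n_gt0 q_irr q_f.
have DA : (n%:Z * a)%:P * 'X ^+ n.-1 * (('X - 1%:P) * ('X - (- 1)%:P))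
        = ('X ^+ 2 + 1) * (fpoly n a)^`() - n.*2%:R * 'X * fpoly n a.
  rewrite deriv_fpoly // addrK polyCM polyCN polyC1 -[n%:Z]natz polyC_natr; ring.
have na_n0 : (n%:Z * a)%:~R != 0 :> 'F_p.
  by rewrite -dvdz_redp dvdzE abszM Euclid_dvdM // negb_or; apply/andP.
have : redp p q %| redp p ((n%:Z * a)%:P * 'X ^+ n.-1 * (('X - 1%:P) * ('X - (- 1)%:P))).
  rewrite DA rmorphB (rmorphM _ ('X ^+ 2 + 1)) (rmorphM _ (_ * _) (fpoly n a)).
  by rewrite dvdp_sub ?dvdp_mull.
move: (n%:Z * a) na_n0 => c c_n0.
(* The constant [n a] is a unit and [X] is prime to [q], so [q] divides [X - 1] or [X + 1]. *)
rewrite !(rmorphM (redp p)) redpC redpXn -mulrA mul_polyC dvdpZr //.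
rewrite Gauss_dvdpr; last by rewrite coprimep_expr // irreducible_poly_coprime.
rewrite !(rmorphB (redp p)) redpX !redpC.
have [q_1 _ | nq_1] := boolP (redp p q %| 'X - (1%:~R)%:P).
  by left; apply: horner_fpoly_in_ideal_sq q_1 f_sq.
rewrite Gauss_dvdpr ?irreducible_poly_coprime // => q_N1.
by right; apply: horner_fpoly_in_ideal_sq q_N1 f_sq.
Qed.

End Ideal.

(** * The discriminant for odd [n], and the theorem *)

(** The powers of [n] and [a] are prime to [p]. If [p] divided both [2^n - a] and [2^n + a], it
    would divide their sum [2^(n+1)], hence 2, hence [a]; so [p^2] must divide a single factor. *)
Lemma dvdz_disc_fpoly p n a : prime p -> odd n ->
    irreducible_poly (map_poly (intr : int -> rat) (fpoly n a)) ->
    ~~ (p %| a)%Z -> ~~ (p %| n)%N ->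
  ((p ^ 2)%:Z %| disc (fpoly n a))%Z =
    ((p ^ 2)%:Z %| 2 ^+ n - a)%Z || ((p ^ 2)%:Z %| 2 ^+ n - (- 1) ^+ n * a)%Z.
Proof.
move=> p_pr n_odd f_irr p_a p_n; have n_gt0 := odd_gt0 n_odd.
have a_n0 : a != 0 by apply: contraNneq p_a => ->; rewrite dvdz0.
rewrite disc_fpoly // -signr_odd n_odd expr1 (mulN1r a) opprK.
have cop (x : int) : ~~ (p %| x)%Z -> coprimez (p ^ 2)%:Z x.
  by move=> p_x; rewrite coprimezE /= coprimeXl // prime_coprime.
rewrite -!mulrA Gauss_dvdzr; last by rewrite coprimezN coprimezE coprimen1.
rewrite Gauss_dvdzr; last by rewrite coprimezXr // natz cop.
rewrite Gauss_dvdzr; last by rewrite coprimezXr ?cop.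
have p_dvd2 (x : int) : ((p ^ 2)%:Z %| x)%Z -> (p %| x)%Z.
  by apply: dvdz_trans; rewrite dvdzE /= dvdn_exp.
have [p_m | np_m] := boolP (p %| 2 ^+ n - a)%Z; last first.
  rewrite Gauss_dvdzr ?cop //; case: (boolP (_ %| 2 ^+ n - a)%Z) => // /p_dvd2.
  by rewrite (negPf np_m).
suff np_p : ~~ (p %| 2 ^+ n + a)%Z.
  rewrite Gauss_dvdzl ?cop //; case: (boolP (_ %| 2 ^+ n + a)%Z) => [/p_dvd2|].
    by rewrite (negPf np_p).
  by rewrite orbF.
apply/negP=> p_p.
have : (p %| 2 ^+ n.+1)%Z.
  have -> : 2 ^+ n.+1 = (2 ^+ n - a) + (2 ^+ n + a) :> int by rewrite exprS; ring.
  exact: rpredD.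
rewrite dvdzE abszX Euclid_dvdX //= => p_2.
move: p_a; rewrite -[a](subKr (2 ^+ n)) rpredB //.
by rewrite dvdzE abszX Euclid_dvdX //= n_gt0.
Qed.

Theorem theorem1p2 (n : nat) (a : int) (p : nat) (theta : algC) (N : nat) :
  (2 <= n)%N ->
  irreducible_poly (map_poly (intr : int -> rat) (fpoly n a)) ->
  root (map_poly (intr : int -> algC) (fpoly n a)) theta ->
  prime p ->
  (p%:Z %| disc (fpoly n a))%Z ->
  is_index theta N ->
  ~~ (p %| N)%N <->
  (if (p%:Z %| a)%Z then ~~ ((p ^ 2)%:Z %| a)%Z
   else if (p %| n)%N then ~~ ((p ^ 2)%:Z %| a ^+ (p ^ logn p n) - a)%Z
   else if odd n then ~~ ((p ^ 2)%:Z %| disc (fpoly n a))%Z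
   else ~~ ((p ^ 2)%:Z %| 2 ^+ n - a)%Z).
Proof.
move=> n_gt1 f_irr f_root p_pr _ N_index; have n_gt0 := ltnW n_gt1.
have [f_mon _] := fpoly_monic_size a n_gt0.
have p_N := prime_dvd_index f_mon f_irr f_root p_pr N_index.
have negb_iff (b c : bool) : (b <-> c) -> (~~ b <-> ~~ c) by case: b c => [] [] [].
have [p_a | p_a] := ifP.
  exact: negb_iff (iff_trans p_N (fpoly_in_ideal_sq_dvd_a p_pr n_gt1 p_a)).
have [p_n | p_n] := ifP.
  exact: negb_iff (iff_trans p_N (fpoly_in_ideal_sq_dvd_n p_pr a n_gt0 p_n)).
have {}p_N := iff_trans p_N (fpoly_in_ideal_sq_coprime p_pr n_gt0 (negbT p_a) (negbT p_n)).
have [n_odd | n_even] := ifP.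
  rewrite dvdz_disc_fpoly ?p_a ?p_n //.
  by apply: negb_iff (iff_trans p_N _); split=> /orP.
(* For even [n] the values at 1 and -1 coincide. *)
apply: negb_iff (iff_trans p_N _); rewrite -signr_odd n_even expr0 mul1r.
by split=> [[]|]; last left.
Qed.
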